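(* For every system $\mathbf f=(f_1,\dots,f_n)$ and every $\mathbf x\in\mathscr M$, $$\gamma(\mathbf f,\mathbf x)\le\frac12\,\mu(\mathbf f,\mathbf x)\,\nu(\mathbf x).$$
   Context: Spaces. Fix $n\ge1$, finite nonempty sets $A_1,\dots,A_n\subset(\mathbb R^n)^*$ (row vectors), and $\rho_{i,\mathbf a}>0$ for $\mathbf a\in A_i$. $\mathscr F_i$ is the space of exponential sums $f_i(\mathbf x)=\sum_{\mathbf a\in A_i}f_{i,\mathbf a}\rho_{i,\mathbf a}e^{\mathbf a\mathbf x}$ on $\mathbb C^n$, with $(\rho_{i,\mathbf a}e^{\mathbf a\mathbf x})_{\mathbf a\in A_i}$ orthonormal, so $\|f_i\|^2=\sum_{\mathbf a}|f_{i,\mathbf a}|^2$. $V_i(\mathbf x)\in\mathscr F_i^*$ is evaluation at $\mathbf x$; in dual coordinates $V_i(\mathbf x)=(\rho_{i,\mathbf a}e^{\mathbf a\mathbf x})_{\mathbf a}$ and $\|V_i(\mathbf x)\|^2=K_i(\mathbf x,\mathbf x)=\sum_{\mathbf a}\rho_{i,\mathbf a}^2e^{2\mathbf a\,\mathrm{Re}(\mathbf x)}$. $\mathscr M=\mathbb C^n/[V]$ is the quotient identifying points of $\mathbb C^n$ with the same image under $[V]=([V_1],\dots,[V_n]):\mathbb C^n\to\mathbb P(\mathscr F_1^* )\times\cdots\times\mathbb P(\mathscr F_n^* )$. $\mathbf f=(f_1,\dots,f_n)$ with each $f_i\in\mathscr F_i\setminus\{0\}$. Momentum and local norms. $\mathbf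 m_i(\mathbf x)=\frac12D\log K_i(\mathbf x,\mathbf x)=\sum_{\mathbf a}p_{i,\mathbf a}(\mathbf x)\,\mathbf a$ with $p_{i,\mathbf a}(\mathbf x)=\rho_{i,\mathbf a}^2e^{2\mathbf a\mathrm{Re}(\mathbf x)}/K_i(\mathbf x,\mathbf x)$. $\langle\cdot,\cdot\rangle_{i,\mathbf x}$ is the pull-back by $[V_i]$ of the Fubini–Study metric: $\|\mathbf u\|_{i,\mathbf x}^2=\sum_{\mathbf a}p_{i,\mathbf a}(\mathbf x)|(\mathbf a-\mathbf m_i(\mathbf x))\mathbf u|^2$; $\|\mathbf u\|_{\mathbf x}^2=\sum_{i=1}^n\|\mathbf u\|_{i,\mathbf x}^2$. $T_{\mathbf x}\mathscr M$ is $\mathbb C^n$ (modulo the common kernel of these seminorms, which is $0$ when $DS_{\mathbf f,\mathbf x}(0)$ below is invertible). Local function. $S_{\mathbf f,\mathbf x}(\dot{\mathbf x})\in\mathbb C^n$ has $i$-th coordinate $\|W_i(\mathbf x)\|^{-1}W_i(\mathbf x+\dot{\mathbf x})(f_i)$, where $W_i(\mathbf y)=e^{-\mathbf m_i(\mathbf x)\mathbf y}V_i(\mathbf y)$ ($\mathbf x$ fixed), so $W_i(\mathbf y)(f_i)=e^{-\mathbf m_i(\mathbf x)\mathbf y}f_i(\mathbf y)$. Invariants. $\mu(\mathbf f,\mathbf x)=\|DS_{\mathbf f,\mathbf x}(0)^{-1}\,\mathrm{diag}(\|f_1\|,\dots,\|f_n\|)\|_{\mathbf x}$, operator norm from $\mathbb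 C^n$ (canonical norm) to $(T_{\mathbf x}\mathscr M,\|\cdot\|_{\mathbf x})$. $\nu(\mathbf x)=\max_i\max_{\mathbf a\in A_i}\sup_{\|\mathbf u\|_{i,\mathbf x}\le1}|(\mathbf a-\mathbf m_i(\mathbf x))\mathbf u|$. $\gamma(\mathbf f,\mathbf x)=\max_{k\ge2}\left(\frac1{k!}\|DS_{\mathbf f,\mathbf x}(0)^{-1}D^kS_{\mathbf f,\mathbf x}(0)\|_{\mathbf x}\right)^{1/(k-1)}$, operator norm of multilinear maps on $(T_{\mathbf x}\mathscr M,\|\cdot\|_{\mathbf x})$. If $DS_{\mathbf f,\mathbf x}(0)$ is not invertible, $\mu=\gamma=\infty$. *)

(* Defs.v *)
From HB Require Import structures.
From mathcomp Require Import all_boot all_order all_algebra.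
From mathcomp Require Import finmap generic_quotient complex.
From mathcomp Require Import all_classical all_reals all_analysis.

Set Implicit Arguments.
Unset Strict Implicit.
Unset Printing Implicit Defensive.

Import Order.TTheory GRing.Theory Num.Theory numFieldNormedType.Exports.

Local Open Scope classical_set_scope.
Local Open Scope quotient_scope.
Local Open Scope complex_scope.
Local Open Scope ring_scope.

(* Modulus as a real number; `|z| would have type R[i].                       *)
Definition cmod (R : realType) (z : R[i]) : R :=
  Num.sqrt (complex.Re z ^+ 2 + complex.Im z ^+ 2).

Definition cexp (R : realType) (z : R[i]) : R[i] :=
  (expR (complex.Re z))%:C * (cos (complex.Im z) +i* sin (complex.Im z)).

Definition hnorm (R : realType) (I : finType) (v : I -> R[i]) : R :=
  Num.sqrt (\sum_i cmod (v i) ^+ 2).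

(* D^k g(y)(u_1, ..., u_k) for us = [:: u_1; ...; u_k], by the recursion
   D^k g(y)(u_1, ..., u_k) = D(z |-> D^(k-1) g(z)(u_2, ..., u_k))(y) u_1,
   all differentials being Frechet differentials over the field C.       *)
Fixpoint iterdiff (C : numFieldType) (U U' : normedModType C) (g : U -> U')
    (us : seq U) : U -> U' :=
  if us is u :: us' then fun y => 'd (iterdiff g us') y u else g.

(* The product of [0, +oo] with 0 * +oo = +oo instead of the library's
   0 * +oo = 0. In the inequality gamma <= mu * nu / 2 the two differ only when
   every A i is a singleton: then nu = 0, DS = 0 and gamma = mu = +oo.        *)
Definition mule_top (R : realType) (x y : \bar R) : \bar R :=
  if ((x == 0%E) && (y == +oo%E)) || ((x == +oo%E) && (y == 0%E))
  then +oo%E else (x * y)%E.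

Section ExponentialSums.
Context (R : realType) (n : nat) (A : 'I_n -> {fset 'rV[R]_n}).
Context (rho : forall i, A i -> R).

(* The coordinates (f_a)_a of f = \sum_a f_a rho_a e^(a x) in the orthonormal
   basis (rho_a e^(a x))_a. Exponentials with distinct exponents are linearly
   independent, so they determine, and are determined by, the function f.     *)
Definition expsum (i : 'I_n) := {ffun A i -> R[i]}.

Implicit Types (i : 'I_n) (x y u : 'cV[R[i]]_n) (f : forall i, expsum i).

Definition pairing (a : 'rV[R]_n) x : R[i] :=
  (map_mx (fun t : R => t%:C) a *m x) 0 0.

(* Elements of the dual of expsum i are given in dual coordinates. *)
Definition V i x (a : A i) : R[i] := (rho a)%:C * cexp (pairing (val a) x).

Definition apply_dual i (w : A i -> R[i]) (g : expsum i) : R[i] :=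
  \sum_(a : A i) g a * w a.

Definition weight i x (a : A i) : R :=
  rho a ^+ 2 * expR (2 * (val a *m map_mx (@complex.Re R) x) 0 0).

Definition K i x : R := \sum_(a : A i) weight x a.

(* x and y have the same image in the product of the projective spaces
   P(F_i^\vee), F_i^\vee being the dual of expsum i.                           *)
Definition sameV x y : bool :=
  `[< forall i, exists2 c : R[i],
    c != 0 & (forall a : A i, V y a = c * V x a) >].

Lemma sameV_refl : reflexive sameV.
Proof.
move=> x; apply/asboolP => i; exists 1; first exact: oner_neq0.
by move=> a; rewrite mul1r.
Qed.

Lemma sameV_sym : symmetric sameV.
Proof.
have H x y : sameV x y -> sameV y x.
  move=> /asboolP h; apply/asboolP => i; have [c c0 hc] := h i.
  exists c^-1; first by rewrite invr_eq0.
  by move=> a; rewrite hc mulKf.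
by move=> x y; apply/idP/idP; exact: H.
Qed.

Lemma sameV_trans : transitive sameV.
Proof.
move=> y x z /asboolP h1 /asboolP h2; apply/asboolP => i.
have [c c0 hc] := h1 i; have [d d0 hd] := h2 i.
exists (d * c); first by rewrite mulf_neq0.
by move=> a; rewrite hd hc mulrA.
Qed.

Canonical sameV_equiv := EquivRel sameV sameV_refl sameV_sym sameV_trans.

Definition quotV : Type := {eq_quot sameV}.

Definition in_class (X : quotV) x : Prop := \pi_({eq_quot sameV}) x = X.

Definition prob i x (a : A i) : R := weight x a / K i x.

(* 1/2 D log K_i *)
Definition momentum i x : 'rV[R]_n := \sum_(a : A i) prob x a *: val a.

Definition locnorm i x u : R :=
  Num.sqrt (\sum_(a : A i)
    prob x a * cmod (pairing (val a - momentum i x) u) ^+ 2).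

Definition xnorm x u : R := Num.sqrt (\sum_i locnorm i x u ^+ 2).

(* W_i at y, normalised at x. *)
Definition W i x y (a : A i) : R[i] :=
  cexp (- pairing (momentum i x) y) * V y a.

Definition locfun f x (xdot : 'cV[R[i]]_n) : 'cV[R[i]]_n :=
  \col_i (((hnorm (@W i x x))^-1)%:C * apply_dual (@W i x (x + xdot)) (f i)).

Definition DS f x : 'M[R[i]]_n :=
  \matrix_(i, j) ('d (locfun f x) 0 (delta_mx j 0)) i 0.

Definition DkS f x (us : seq 'cV[R[i]]_n) : 'cV[R[i]]_n :=
  iterdiff (locfun f x) us 0.

(* Below, the tangent space (C^n modulo the common kernel of the seminorms) is
   C^n itself, as that kernel is 0 whenever DS f x is invertible.             *)

Definition mu f x : \bar R :=
  if DS f x \in unitmx then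
    ereal_sup [set (xnorm x (invmx (DS f x) *m
                      diag_mx (\row_i (hnorm (f i))%:C) *m v))%:E
              | v in [set v : 'cV[R[i]]_n | hnorm (fun j => v j 0) <= 1]]
  else +oo%E.

Definition nu x : \bar R :=
  \big[maxe/-oo%E]_(i < n) \big[maxe/-oo%E]_(a : A i)
    ereal_sup [set (cmod (pairing (val a - momentum i x) u))%:E
              | u in [set u | locnorm i x u <= 1]].

Definition multinorm x (k : nat) (T : seq 'cV[R[i]]_n -> 'cV[R[i]]_n) :
    \bar R :=
  ereal_sup [set (xnorm x (T us))%:E
            | us in [set us : k.-tuple 'cV[R[i]]_n |
                      forall j, xnorm x (tnth us j) <= 1]].

Definition gamma f x : \bar R :=
  if DS f x \in unitmx then
    ereal_sup [set (((k`!%:R)^-1)%:E *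
                     multinorm x k (fun us => (invmx (DS f x) *m DkS f x us)%R))%E
                   `^ (k.-1%:R)^-1
              | k in [set k : nat | (2 <= k)%N]]%E
  else +oo%E.

End ExponentialSums.

(* Main.v *)
(* The i-th coordinate of the local function is a combination of exponentials
   e^((a - m_i) y), so D^k S_i(0)(u_1, ..., u_k) is
   \sum_a f_a W_a / |W_i| \prod_j (a - m_i) u_j, where |W_a|^2 / |W_i|^2 = p_a.
   By Cauchy-Schwarz it is at most |f_i| nu^(k-1) \prod_j |u_j|_i, whence
   |DS^-1 D^k S(0)|_x <= mu nu^(k-1). The case k = 1 of the same estimate says
   that the inverse of DS^-1 diag(|f_i|) has norm at most 1, so mu >= 1; together
   with 2^(k-1) <= k! this gives mu nu^(k-1) / k! <= (mu nu / 2)^(k-1). *)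

Require Import Defs.
From HB Require Import structures.
From mathcomp Require Import all_boot all_order all_algebra.
From mathcomp Require Import finmap generic_quotient complex.
From mathcomp Require Import all_classical all_reals all_analysis.
From mathcomp Require Import ring lra.

Set Implicit Arguments.
Unset Strict Implicit.
Unset Printing Implicit Defensive.

Import Order.TTheory GRing.Theory Num.Theory numFieldNormedType.Exports.

Local Open Scope ring_scope.

(** * Differentials of abstract exponentials and of finite sums *)

(** The functional equation carries the expansion at 0 to any [z], since e(z+h) - e(z) - e(z)h =
    e(z)(e(h) - 1 - h). *)
Lemma is_diff_exponential (K : numFieldType) (e : K -> K)
    (eD : forall z h, e (z + h) = e z * e h)
    (e0 : forall eps : K, 0 < eps ->
      \forall h \near (0 : K), `|e h - 1 - h| <= eps * `|h|) (z : K) :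
  is_diff z e ( *:%R (e z)).
Proof.
have cont : continuous ( *:%R (e z) : K -> K) by exact: scaler_continuous.
have lin : e \o shift z = cst (e z) + ( *:%R (e z) : K -> K) +o_ (0 : K) id.
  apply/eqaddoP => eps eps_gt0.
  (* The [+ 1] makes the divisor of [eps] positive whatever the value of [e z]. *)
  have c_gt0 : 0 < `|e z| + 1 by rewrite ltr_wpDl.
  near=> h.
  have -> : (e \o shift z - (cst (e z) + *:%R (e z))) h = e z * (e h - 1 - h).
    rewrite -[LHS]/(e (h + z) - (e z + e z * h)) addrC eD; ring.
  rewrite normrM.
  apply: (@le_trans _ _ ((`|e z| + 1) * (eps / (`|e z| + 1) * `|h|))).
    rewrite ler_pM// ?lerDl//.
    near: h; apply: e0; exact: divr_gt0.
  by rewrite mulrA mulrCA divff ?mulr1// gt_eqF.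
have d : 'd e z = *:%R (e z) :> (K -> K) by exact: diff_unique.
by split=> //; apply/diff_locallyP; rewrite d.
Unshelve. all: by end_near. Qed.

Lemma is_diff_sum (K : numFieldType) (V W : normedModType K) (J : Type)
    (r : seq J) (F dF : J -> V -> W) (y : V) :
  (forall j, is_diff y (F j) (dF j)) ->
  is_diff y (fun z => \sum_(j <- r) F j z) (fun z => \sum_(j <- r) dF j z).
Proof.
move=> FdF; elim: r => [|j r ih].
  under [in X in is_diff _ X _]eq_fun do rewrite big_nil.
  under [in X in is_diff _ _ X]eq_fun do rewrite big_nil.
  exact: is_diff_cst.
under [in X in is_diff _ X _]eq_fun do rewrite big_cons.
under [in X in is_diff _ _ X]eq_fun do rewrite big_cons.
exact: is_diffD.
Qed.

(** * Iterated differentials of sums of exponentials of linear forms *)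

Section IteratedDifferentials.
Context (K : numFieldType) (e : K -> K).
Hypothesis de : forall z : K, is_diff z e ( *:%R (e z)).
Context (n : nat) (W : normedModType K) (J : finType) (b : J -> 'rV[K]_n).

Let l j (z : 'cV[K]_n) : K := (b j *m z) 0 0.

Lemma is_diff_coord (k : 'I_n) (y : 'cV[K]_n) :
  is_diff y (fun z : 'cV[K]_n => z k 0 : K) (fun z => z k 0).
Proof.
have lin : linear (fun z : 'cV[K]_n => z k 0 : K) by move=> c u v; rewrite !mxE.
pose L : {linear _ -> _} :=
  HB.pack (fun z : 'cV[K]_n => z k 0) (GRing.isLinear.Build _ _ _ _ _ lin).
apply: DiffDef; first exact: differentiable_coord.
exact: (@diff_lin _ _ _ L _ (@coord_continuous _ _ _ _ _)).
Qed.

Lemma is_diff_mulmx (j : J) (y : 'cV[K]_n) : is_diff y (l j) (l j).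
Proof.
have -> : l j = fun z : 'cV[K]_n => \sum_k b j 0 k *: (z k 0 : K).
  by apply/funext => z; rewrite /l mxE.
by apply: is_diff_sum => k; apply: is_diffZ; exact: is_diff_coord.
Qed.

Lemma is_diff_expsum (w : J -> W) (y : 'cV[K]_n) :
  is_diff y (fun z => \sum_j e (l j z) *: w j)
            (fun u => \sum_j (e (l j y) * l j u) *: w j).
Proof.
apply: is_diff_sum => j.
have dele : is_diff y (e \o l j) ( *:%R (e (l j y)) \o l j).
  by apply: is_diff_comp; first exact: is_diff_mulmx.
have dw : is_diff ((e \o l j) y) ( *:%R^~ (w j)) ( *:%R^~ (w j)).
  exact: is_diff_scalel.
exact: (is_diff_comp dele dw).
Qed.

(** Differentiating along [u] only multiplies the j-th coefficient by [l j u], so the class of such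
    sums is stable. Coefficients in [W] allow vector-valued functions. *)
Lemma iterdiff_expsum (w : J -> W) (us : seq 'cV[K]_n) (y : 'cV[K]_n) :
  iterdiff (fun z => \sum_j e (l j z) *: w j) us y =
  \sum_j (e (l j y) * \prod_(u <- us) l j u) *: w j.
Proof.
elim: us y => [|u us ih] y /=.
  by apply: eq_bigr => j _; rewrite big_nil mulr1.
(* The factors already produced are absorbed into the coefficients, which leaves a sum of the
   original form to differentiate once. *)
pose w' j := (\prod_(v <- us) l j v) *: w j.
have -> : iterdiff (fun z => \sum_j e (l j z) *: w j) us =
    fun z => \sum_j e (l j z) *: w' j.
  apply/funext => z; rewrite ih; apply: eq_bigr => j _.
  by rewrite /w' scalerA.
rewrite (diff_val (is_diff_def := is_diff_expsum w' y)).
by apply: eq_bigr => j _; rewrite /w' big_cons scalerA mulrA.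
Qed.

End IteratedDifferentials.

(** * Modulus and differential of the complex exponential *)

Section ComplexExponential.
Local Open Scope complex_scope.
Variable R : realType.
Implicit Types z h : R[i].

Lemma normc_cmod z : `|z| = (cmod z)%:C.
Proof. exact: normc_def. Qed.

Lemma cmod_ge0 z : 0 <= cmod z.
Proof. exact: sqrtr_ge0. Qed.

Lemma cmod0 : cmod (0 : R[i]) = 0.
Proof. by apply: complexI; rewrite -normc_cmod normr0. Qed.

Lemma cmodM z h : cmod (z * h) = cmod z * cmod h.
Proof. by apply: complexI; rewrite rmorphM/= -!normc_cmod normrM. Qed.

Lemma cmod_real (r : R) : cmod r%:C = `|r|.
Proof. by rewrite /cmod/= expr0n addr0 sqrtr_sqr. Qed.

Lemma cmod_sum (I : finType) (F : I -> R[i]) :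
  cmod (\sum_i F i) <= \sum_i cmod (F i).
Proof.
elim/big_ind2 : _ => [|z1 r1 z2 r2 h1 h2|//]; first by rewrite cmod0.
apply: le_trans (lerD h1 h2).
by rewrite -lecR rmorphD/= -!normc_cmod ler_normD.
Qed.

Lemma cmod_prod (I : Type) (r : seq I) (F : I -> R[i]) :
  cmod (\prod_(i <- r) F i) = \prod_(i <- r) cmod (F i).
Proof.
elim: r => [|j r ih]; first by rewrite !big_nil -[1]/(1%:C) cmod_real normr1.
by rewrite !big_cons cmodM ih.
Qed.

Lemma cmod_le_sum z : cmod z <= `|complex.Re z| + `|complex.Im z|.
Proof.
rewrite -(@ler_pXn2r _ 2)// ?nnegrE ?addr_ge0// ?cmod_ge0//.
rewrite sqr_sqrtr ?addr_ge0 ?sqr_ge0// sqrrD !real_normK ?num_real//.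
by rewrite lerD2r lerDl mulrn_wge0// mulr_ge0.
Qed.

Lemma Re_le_cmod z : `|complex.Re z| <= cmod z.
Proof. by rewrite -lecR -normc_cmod normc_ge_Re. Qed.

Lemma Im_le_cmod z : `|complex.Im z| <= cmod z.
Proof.
by rewrite -sqrtr_sqr ler_sqrt ?addr_ge0 ?sqr_ge0// lerDr sqr_ge0.
Qed.

Lemma cexp0 : cexp (0 : R[i]) = 1.
Proof. by rewrite /cexp/= expR0 cos0 sin0 mul1r. Qed.

Lemma cexpD z h : cexp (z + h) = cexp z * cexp h.
Proof.
case: z h => [a b] [c d]; rewrite /cexp /=.
rewrite expRD cosD sinD; simpc; congr (_ +i* _); ring.
Qed.

Lemma cmod_cexp z : cmod (cexp z) = expR (complex.Re z).
Proof.
by rewrite /cexp cmodM cmod_real ger0_norm ?expR_ge0// /cmod/= cos2Dsin2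
  sqrtr1 mulr1.
Qed.

Lemma is_derive_near0 (g : R -> R) (dg eps : R) : is_derive (0 : R) 1 g dg ->
  0 < eps -> \forall t \near (0 : R), `|g t - g 0 - t * dg| <= eps * `|t|.
Proof.
move=> [/derivable1_diffP gd gdg] eps_gt0.
have /diff_locallyP[_ /eqaddoP/(_ _ eps_gt0)] := gd.
apply: filterS => t; rewrite (deriv1E (f := g)); last exact/derivable1_diffP.
rewrite derive1E gdg /=.
congr (`| _ | <= _).
by rewrite -[LHS]/(g (t + 0) - (g 0 + t * dg)) addr0 opprD addrA.
Qed.

(** For h = s + it, the real part e^s cos t - 1 - s and the imaginary part e^s sin t - t are
    estimated from the real expansions of exp, sin and cos at 0. *)
Lemma cexp_near0 (eps : R[i]) : 0 < eps ->
  \forall h \near (0 : (R[i])^o), `|cexp h - 1 - h| <= eps * `|h|.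
Proof.
(* In the order of [R[i]], a positive number is real. *)
case: eps => e e'; rewrite ltcE/= => /andP[/eqP-> e_gt0] {e'}.
(* With N = |h|, the real part will cost 4dN and the imaginary part 5dN. *)
pose d := e / 9.
have d_gt0 : 0 < d by rewrite divr_gt0.
have Hexp := is_derive_near0 (is_derive_expR 0) d_gt0.
(* This coarser expansion yields |e^s - 1| <= 2N, and then e^s <= 3 once N < 1. *)
have Hexp1 := is_derive_near0 (is_derive_expR 0) ltr01.
have Hsin := is_derive_near0 (is_derive_sin 0) d_gt0.
have Hcos := is_derive_near0 (is_derive_cos 0) d_gt0.
have E1 t : expR t - expR 0 - t * expR 0 = expR t - 1 - t :> R.
  by rewrite expR0 mulr1.
have E2 t : sin t - sin 0 - t * cos 0 = sin t - t :> R.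
  by rewrite sin0 cos0 mulr1 subr0.
have E3 t : cos t - cos 0 - t * - sin 0 = cos t - 1 :> R.
  by rewrite sin0 cos0 oppr0 mulr0 subr0.
have {}Hexp : \forall t \near (0 : R), `|expR t - 1 - t| <= d * `|t|.
  by apply: filterS Hexp => t; rewrite E1.
have {}Hexp1 : \forall t \near (0 : R), `|expR t - 1 - t| <= 1 * `|t|.
  by apply: filterS Hexp1 => t; rewrite E1.
have {}Hsin : \forall t \near (0 : R), `|sin t - t| <= d * `|t|.
  by apply: filterS Hsin => t; rewrite E2.
have {}Hcos : \forall t \near (0 : R), `|cos t - 1| <= d * `|t|.
  by apply: filterS Hcos => t; rewrite E3.
have /nbhs_norm0P[/= r r_gt0 Hr] : \forall t \near (0 : R),
  [/\ `|expR t - 1 - t| <= d * `|t|, `|expR t - 1 - t| <= 1 * `|t|,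
      `|sin t - t| <= d * `|t| & `|cos t - 1| <= d * `|t|].
  by near=> t; split; near: t.
(* Radius below 1 gives e^s <= 3; radius below [d] bounds the second-order term (e^s - 1)t by
   2dN. *)
apply/nbhs_norm0P; exists (Num.min r (Num.min 1 d))%:C => /=.
  by rewrite ltcR !lt_min r_gt0 d_gt0 ltr01.
move=> [s t]; rewrite /= normc_cmod ltcR !lt_min => /and3P[hr h1 hd].
have Re_le := Re_le_cmod (s +i* t); have Im_le := Im_le_cmod (s +i* t).
have [X1 X2 _ _] := Hr s (le_lt_trans Re_le hr).
have [_ _ S1 C1] := Hr t (le_lt_trans Im_le hr).
rewrite /= in Re_le Im_le.
rewrite !normc_cmod -[e +i* 0]/(e%:C) -rmorphM/= lecR.
apply: (le_trans (cmod_le_sum _)).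
rewrite /cexp; simpc => /=.
set N := cmod _ in hr h1 hd Re_le Im_le *.
have N0 : 0 <= N by exact: cmod_ge0.
have dN (t' : R) : `|t'| <= N -> d * `|t'| <= d * N.
  by move=> ?; rewrite ler_pM2l.
have {}X1 := le_trans X1 (dN _ Re_le).
have {}S1 := le_trans S1 (dN _ Im_le).
have {}C1 := le_trans C1 (dN _ Im_le).
have Y : `|expR s - 1| <= 2 * N.
  rewrite -(subrK s (expR s - 1)) (le_trans (ler_normD _ _))//; lra.
have Y' : expR s <= 3 by have := ler_norm (expR s - 1); lra.
have eE : e = 9 * d by rewrite /d; field.
have Z1 : `|expR s * cos t - 1 - s| <= d * N + 3 * (d * N).
  have -> : expR s * cos t - 1 - s = (expR s - 1 - s) + expR s * (cos t - 1).
    by ring.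
  rewrite (le_trans (ler_normD _ _))// lerD// normrM ger0_norm ?expR_ge0//.
  by rewrite ler_pM ?expR_ge0.
have Z2 : `|expR s * sin t - t| <= 3 * (d * N) + 2 * d * N.
  have -> : expR s * sin t - t = expR s * (sin t - t) + (expR s - 1) * t.
    by ring.
  rewrite (le_trans (ler_normD _ _))// lerD// normrM.
    by rewrite ger0_norm ?expR_ge0// ler_pM ?expR_ge0.
  rewrite ler_pM//; lra.
apply: le_trans (lerD Z1 Z2) _; rewrite eE; lra.
Unshelve. all: by end_near. Qed.

Lemma is_diff_cexp (z : (R[i])^o) :
  is_diff z (@cexp R : (R[i])^o -> (R[i])^o) ( *:%R (cexp z)).
Proof. apply: is_diff_exponential; [exact: cexpD|exact: cexp_near0]. Qed.

End ComplexExponential.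

(** * Derivatives of the local function at 0, and its normalized coefficients *)

Section LocalFunction.
Local Open Scope complex_scope.
Context (R : realType) (n : nat) (A : 'I_n -> {fset 'rV[R]_n}).
Context (rho : forall i, A i -> R).
Implicit Types (i : 'I_n) (x y z u : 'cV[R[i]]_n) (f : forall i, expsum A i).

Lemma pairingE (a : 'rV[R]_n) z : pairing a z = \sum_k (a 0 k)%:C * z k 0.
Proof. by rewrite /pairing mxE; apply: eq_bigr => k _; rewrite mxE. Qed.

Lemma pairingD (a : 'rV[R]_n) y z :
  pairing a (y + z) = pairing a y + pairing a z.
Proof. by rewrite /pairing mulmxDr mxE. Qed.

Lemma pairingB (a b : 'rV[R]_n) z :
  pairing (a - b) z = pairing a z - pairing b z.
Proof. by rewrite /pairing map_mxB mulmxBl !mxE. Qed.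

Lemma Re_pairing (a : 'rV[R]_n) z :
  complex.Re (pairing a z) = (a *m map_mx (@complex.Re R) z) 0 0.
Proof.
rewrite pairingE mxE -[LHS]/((@complex.Re R : Rcomplex R -> R) _) raddf_sum.
by apply: eq_bigr => k _; rewrite mxE; case: (z k 0) => s t /=; simpc.
Qed.

(** The twist e^(-m_i y) turns each exponent a into a - m_i, the linear form that occurs in the
    local norm. *)
Lemma W_shift i x z (a : A i) :
  W rho x (x + z) a = W rho x x a * cexp (pairing (val a - momentum rho i x) z).
Proof.
rewrite /W /V !pairingD pairingB !opprD !cexpD; ring.
Qed.

Definition normalizedW i x (a : A i) : R[i] :=
  ((hnorm (W rho x x (i := i)))^-1)%:C * W rho x x a.

(** Indexing by pairs (i, a) makes the n coordinate sums one vector-valued sum; coordinate i keeps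
    only the terms tagged i. *)
Lemma sum_tagged_delta (F : forall i, A i -> R[i]) i :
  (\sum_(j : {i & A i}) F (tag j) (tagged j) *:
     (delta_mx (tag j) 0 : 'cV[R[i]]_n)) i 0 = \sum_(a : A i) F i a.
Proof.
rewrite -(sig_big_dep (fun=> true) (fun=> predT)
  (fun i (a : A i) => F i a *: (delta_mx i 0 : 'cV[R[i]]_n))) /=.
rewrite summxE (bigD1 i)//= [X in _ + X]big1 ?addr0 ?summxE.
  by apply: eq_bigr => a _; rewrite !mxE !eqxx mulr1.
move=> j ji; rewrite summxE big1// => a _.
by rewrite !mxE eq_sym (negPf ji) !mulr0.
Qed.

(** Brings the local function to the form that [iterdiff_expsum] differentiates. *)
Lemma locfunE f x : locfun rho f x = fun z =>
  \sum_(j : {i & A i})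
    cexp ((map_mx (fun t : R => t%:C) (val (tagged j) - momentum rho (tag j) x)
           *m z) 0 0)
    *: ((f (tag j) (tagged j) * normalizedW x (tagged j)) *:
          delta_mx (tag j) 0).
Proof.
apply/funext => z; under eq_bigr do rewrite scalerA.
apply/colP => i; rewrite mxE /apply_dual mulr_sumr.
rewrite (sum_tagged_delta (fun i (a : A i) =>
  cexp (pairing (val a - momentum rho i x) z) * (f i a * normalizedW x a))).
by apply: eq_bigr => a _; rewrite W_shift /normalizedW; ring.
Qed.

Lemma DkSE f x us i : DkS rho f x us i 0 =
  \sum_(a : A i) f i a * normalizedW x a *
  \prod_(u <- us) pairing (val a - momentum rho i x) u.
Proof.
rewrite /DkS locfunE (iterdiff_expsum (@is_diff_cexp R)).
under eq_bigr do rewrite scalerA mulmx0 mxE cexp0 mul1r mulrC.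
exact: (sum_tagged_delta (fun i (a : A i) => f i a * normalizedW x a *
  \prod_(u <- us) pairing (val a - momentum rho i x) u)).
Qed.

Lemma pairing_delta (a : 'rV[R]_n) k : pairing a (delta_mx k 0) = (a 0 k)%:C.
Proof. by rewrite /pairing -colE !mxE. Qed.

(** The columns of [DS] are first derivatives along basis vectors, and [pairing] is linear in [u].
    Estimates on [DkS] thus apply to [DS] as the case k = 1. *)
Lemma DSE f x u : DS rho f x *m u = DkS rho f x [:: u].
Proof.
apply/colP => i; rewrite DkSE mxE.
under eq_bigr => k _.
  rewrite mxE -[X in X * _]/(DkS rho f x [:: delta_mx k 0] i 0) DkSE mulr_suml.
  over.
rewrite exchange_big/=; apply: eq_bigr => a _.
rewrite big_seq1 pairingE mulr_sumr; apply: eq_bigr => k _.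
by rewrite big_seq1 pairing_delta mulrA.
Qed.

Hypothesis rho_gt0 : forall i (a : A i), 0 < rho a.
Hypothesis A_neq0 : forall i, A i != fset0.

Lemma weight_gt0 i x (a : A i) : 0 < weight rho x a.
Proof. by rewrite mulr_gt0 ?exprn_gt0 ?expR_gt0. Qed.

Lemma K_gt0 i x : 0 < K rho i x.
Proof.
have /fset0Pn[a Aa] := A_neq0 i.
rewrite /K (bigD1 [` Aa]%fset)//= ltr_wpDr ?weight_gt0//.
by apply: sumr_ge0 => b _; rewrite ltW ?weight_gt0.
Qed.

Lemma cmod_W i x (a : A i) : cmod (W rho x x a) ^+ 2 =
  expR (- complex.Re (pairing (momentum rho i x) x)) ^+ 2 * weight rho x a.
Proof.
rewrite /W cmodM cmod_cexp /V cmodM cmod_cexp cmod_real !exprMn.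
rewrite real_normK ?num_real// /weight -Re_pairing expRM_natl.
by case: (pairing (momentum rho i x) x).
Qed.

Lemma hnorm_W i x : hnorm (W rho x x (i := i)) ^+ 2 =
  expR (- complex.Re (pairing (momentum rho i x) x)) ^+ 2 * K rho i x.
Proof.
rewrite sqr_sqrtr; last by apply: sumr_ge0 => a _; exact: sqr_ge0.
by rewrite mulr_sumr; apply: eq_bigr => a _; rewrite cmod_W.
Qed.

(** The factor exp(-Re(m_i x))^2 is common to all exponents and cancels, leaving [weight] over
    [K]. *)
Lemma cmod_normalizedW i x (a : A i) :
  cmod (normalizedW x a) ^+ 2 = prob rho x a.
Proof.
rewrite /normalizedW cmodM cmod_real exprMn real_normK ?num_real// exprVn.
rewrite hnorm_W cmod_W mulrC -mulf_div divff ?mul1r//.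
by rewrite expf_neq0// gt_eqF// expR_gt0.
Qed.

End LocalFunction.

(** * The Hermitian norm and the Cauchy-Schwarz inequality *)

Section HermitianNorm.
Local Open Scope complex_scope.
Context (R : realType) (I : finType).
Implicit Types v w : I -> R[i].

Lemma hnorm_sqr v : hnorm v ^+ 2 = \sum_i cmod (v i) ^+ 2.
Proof. by rewrite sqr_sqrtr// sumr_ge0// => i _; exact: sqr_ge0. Qed.

Lemma hnorm_ge0 v : 0 <= hnorm v.
Proof. exact: sqrtr_ge0. Qed.

Lemma cmod_le_hnorm v i : cmod (v i) <= hnorm v.
Proof.
rewrite -(@ler_pXn2r _ 2)// ?nnegrE ?hnorm_ge0 ?cmod_ge0// hnorm_sqr.
by rewrite (bigD1 i)//= lerDl sumr_ge0// => j _; exact: sqr_ge0.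
Qed.

Lemma hnorm0_eq0 v : hnorm v = 0 -> forall i, v i = 0.
Proof.
move=> v0 i; apply/eqP; rewrite -normr_eq0 normc_cmod.
rewrite (_ : cmod (v i) = 0)//.
by apply: le_anti; rewrite cmod_ge0 -v0 cmod_le_hnorm.
Qed.

Lemma hnormZ (t : R) v : 0 <= t -> hnorm (fun i => t%:C * v i) = t * hnorm v.
Proof.
move=> t0; apply/eqP; rewrite -(@eqrXn2 _ 2)// ?mulr_ge0 ?hnorm_ge0//.
rewrite exprMn !hnorm_sqr mulr_sumr; apply/eqP; apply: eq_bigr => i _.
by rewrite cmodM cmod_real exprMn ger0_norm.
Qed.

(** Lagrange's identity: the double sum of (a_i b_j - a_j b_i)^2 is twice the difference of the two
    sides. *)
Lemma sum_mul_sqr_le (a b : I -> R) :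
  (\sum_i a i * b i) ^+ 2 <= (\sum_i a i ^+ 2) * (\sum_i b i ^+ 2).
Proof.
have : 0 <= \sum_i \sum_j (a i * b j - a j * b i) ^+ 2.
  by apply: sumr_ge0 => i _; apply: sumr_ge0 => j _; exact: sqr_ge0.
have -> : \sum_i \sum_j (a i * b j - a j * b i) ^+ 2 =
    \sum_i \sum_j (a i ^+ 2 * b j ^+ 2) + \sum_i \sum_j (a j ^+ 2 * b i ^+ 2) -
    2 * \sum_i \sum_j (a i * b i) * (a j * b j).
  rewrite mulr_sumr -big_split -sumrB/=; apply: eq_bigr => i _.
  rewrite mulr_sumr -big_split -sumrB/=; apply: eq_bigr => j _; ring.
rewrite [X in _ + X - _]exchange_big/= -!big_distrlr/= -expr2; lra.
Qed.

Lemma cauchy_schwarz v w :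
  cmod (\sum_i v i * w i) ^+ 2 <= hnorm v ^+ 2 * \sum_i cmod (w i) ^+ 2.
Proof.
rewrite hnorm_sqr; apply: le_trans (sum_mul_sqr_le _ _).
rewrite lerXn2r ?nnegrE ?cmod_ge0//.
  by apply: sumr_ge0 => i _; rewrite mulr_ge0 ?cmod_ge0.
apply: le_trans (cmod_sum _) _.
by apply: ler_sum => i _; rewrite cmodM.
Qed.

End HermitianNorm.

(** * Local norms and coordinatewise bounds on the derivatives *)

Section Estimates.
Local Open Scope complex_scope.
Context (R : realType) (n : nat) (A : 'I_n -> {fset 'rV[R]_n}).
Context (rho : forall i, A i -> R) (f : forall i, expsum A i).
Hypothesis rho_gt0 : forall i (a : A i), 0 < rho a.
Hypothesis A_neq0 : forall i, A i != fset0.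
Variable x : 'cV[R[i]]_n.
Implicit Types (i : 'I_n) (u v : 'cV[R[i]]_n).

Lemma prob_gt0 i (a : A i) : 0 < prob rho x a.
Proof. by rewrite divr_gt0 ?weight_gt0 ?K_gt0. Qed.

Lemma locnorm_sqr i u : locnorm rho i x u ^+ 2 = \sum_(a : A i)
  prob rho x a * cmod (pairing (val a - momentum rho i x) u) ^+ 2.
Proof.
rewrite sqr_sqrtr// sumr_ge0// => a _.
by rewrite mulr_ge0 ?sqr_ge0// ltW// prob_gt0.
Qed.

Lemma xnorm_sqr u : xnorm rho x u ^+ 2 = \sum_i locnorm rho i x u ^+ 2.
Proof. by rewrite sqr_sqrtr// sumr_ge0// => i _; exact: sqr_ge0. Qed.

Lemma locnorm_ge0 i u : 0 <= locnorm rho i x u.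
Proof. exact: sqrtr_ge0. Qed.

Lemma xnorm_ge0 u : 0 <= xnorm rho x u.
Proof. exact: sqrtr_ge0. Qed.

Lemma locnorm_le_xnorm i u : locnorm rho i x u <= xnorm rho x u.
Proof.
rewrite -(@ler_pXn2r _ 2)// ?nnegrE ?locnorm_ge0 ?xnorm_ge0// xnorm_sqr.
by rewrite (bigD1 i)//= lerDl sumr_ge0// => j _; exact: sqr_ge0.
Qed.

Lemma pairingZ (a : 'rV[R]_n) (t : R[i]) u :
  pairing a (t *: u) = t * pairing a u.
Proof. by rewrite /pairing -scalemxAr mxE. Qed.

Lemma locnormZ i (t : R) u : 0 <= t ->
  locnorm rho i x (t%:C *: u) = t * locnorm rho i x u.
Proof.
move=> t0; apply/eqP; rewrite -(@eqrXn2 _ 2)// ?mulr_ge0 ?locnorm_ge0//.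
rewrite exprMn !locnorm_sqr mulr_sumr; apply/eqP; apply: eq_bigr => a _.
by rewrite pairingZ cmodM cmod_real exprMn ger0_norm// mulrCA.
Qed.

Lemma xnormZ (t : R) u : 0 <= t -> xnorm rho x (t%:C *: u) = t * xnorm rho x u.
Proof.
move=> t0; apply/eqP; rewrite -(@eqrXn2 _ 2)// ?mulr_ge0 ?xnorm_ge0//.
rewrite exprMn !xnorm_sqr mulr_sumr; apply/eqP; apply: eq_bigr => i _.
by rewrite locnormZ// exprMn.
Qed.

Lemma locnorm0 i : locnorm rho i x 0 = 0.
Proof.
by rewrite -(scale0r 0) -[0 in X in locnorm _ _ _ X]/(0%:C) locnormZ// mul0r.
Qed.

Lemma xnorm0 : xnorm rho x 0 = 0.
Proof.
by rewrite -(scale0r 0) -[0 in X in xnorm _ _ X]/(0%:C) xnormZ// mul0r.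
Qed.

Lemma pairing_le_nu (N : R) i (a : A i) u : (nu rho x <= N%:E)%E ->
  cmod (pairing (val a - momentum rho i x) u) <= N * locnorm rho i x u.
Proof.
move=> nuN.
have unit_le v : locnorm rho i x v <= 1 ->
    cmod (pairing (val a - momentum rho i x) v) <= N.
  move=> v1; rewrite -lee_fin; apply: le_trans nuN.
  apply: (bigmax_sup i) => //; apply: (bigmax_sup a) => //.
  by apply: ereal_sup_ubound; exists v.
(* A null vector of the seminorm cannot be rescaled to norm 1; but all p_a are positive, so each (a
   - m_i)u vanishes. *)
have [L0|L_gt0] := eqVneq (locnorm rho i x u) 0.
  rewrite L0 mulr0 -(@ler_pXn2r _ 2)// ?nnegrE ?cmod_ge0// expr0n/=.
  rewrite -(pmulr_rle0 _ (prob_gt0 a)).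
  rewrite (_ : 0 = locnorm rho i x u ^+ 2); last by rewrite L0 expr0n.
  rewrite locnorm_sqr (bigD1 a)//= lerDl sumr_ge0// => b _.
  by rewrite mulr_ge0 ?sqr_ge0// ltW// prob_gt0.
have {}L_gt0 : 0 < locnorm rho i x u by rewrite lt_def L_gt0 locnorm_ge0.
have := unit_le (((locnorm rho i x u)^-1)%:C *: u).
rewrite locnormZ ?invr_ge0 ?locnorm_ge0// mulVf ?gt_eqF// => /(_ (lexx _)).
rewrite pairingZ cmodM cmod_real ger0_norm ?invr_ge0 ?locnorm_ge0//.
by rewrite mulrC ler_pdivrMr.
Qed.

(** Cauchy-Schwarz separates the f_a from the remaining factors, and |W_a|^2 / |W_i|^2 = p_a. *)
Lemma cmod_DkS_le i us : cmod (DkS rho f x us i 0) ^+ 2 <=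
  hnorm (f i) ^+ 2 * \sum_(a : A i) prob rho x a *
    \prod_(u <- us) cmod (pairing (val a - momentum rho i x) u) ^+ 2.
Proof.
rewrite DkSE; under eq_bigr do rewrite -mulrA.
apply: le_trans (cauchy_schwarz _ _) _; rewrite ler_wpM2l ?sqr_ge0//.
apply: ler_sum => a _.
by rewrite cmodM cmod_prod exprMn cmod_normalizedW -prodrXl.
Qed.

Lemma cmod_DS_le i u :
  cmod ((DS rho f x *m u) i 0) <= hnorm (f i) * locnorm rho i x u.
Proof.
rewrite -(@ler_pXn2r _ 2)//
  ?nnegrE ?mulr_ge0 ?hnorm_ge0 ?locnorm_ge0 ?cmod_ge0//.
rewrite DSE exprMn locnorm_sqr (le_trans (cmod_DkS_le _ _))//.
by rewrite ler_wpM2l ?sqr_ge0//; under eq_bigr do rewrite big_seq1.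
Qed.

(** Only the directions in [us] are bounded pointwise by [N]. The factor of [u] stays in the
    p-weighted sum and rebuilds its local norm, so the exponent of [N] is k - 1. *)
Lemma cmod_DkS_cons_le (N : R) i u us : 0 <= N -> (nu rho x <= N%:E)%E ->
  (forall v, v \in us -> xnorm rho x v <= 1) ->
  cmod (DkS rho f x (u :: us) i 0) ^+ 2 <=
  (hnorm (f i) * N ^+ size us * locnorm rho i x u) ^+ 2.
Proof.
move=> N0 nuN us1; apply: le_trans (cmod_DkS_le _ _) _.
rewrite -mulrA exprMn ler_wpM2l ?sqr_ge0// exprMn mulrC locnorm_sqr mulr_suml.
apply: ler_sum => a _; rewrite big_cons mulrA ler_wpM2l//.
  by rewrite mulr_ge0 ?sqr_ge0// ltW// prob_gt0.
elim: us us1 => [|v us ih] us1; first by rewrite big_nil expr0 expr1n.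
rewrite big_cons [size _]/= (exprS N) exprMn ler_pM ?sqr_ge0//.
- by apply: prodr_ge0 => w _; exact: sqr_ge0.
- rewrite lerXn2r ?nnegrE ?cmod_ge0//.
  apply: le_trans (pairing_le_nu _ _ nuN) _; rewrite ler_piMr//.
  by apply: le_trans (locnorm_le_xnorm _ _) _; rewrite us1 ?mem_head.
- by apply: ih => w wus; rewrite us1// inE wus orbT.
Qed.

Hypothesis n_ge1 : (1 <= n)%N.

(** The maxima start at [-oo], so an actual index i and exponent a are exhibited, with u = 0. *)
Lemma nu_ge0 : (0 <= nu rho x)%E.
Proof.
have /fset0Pn[a Aa] := A_neq0 (Ordinal n_ge1).
apply: (bigmax_sup (Ordinal n_ge1)) => //.
apply: (bigmax_sup [` Aa]%fset) => //.
apply: ereal_sup_ubound; exists 0; first by rewrite /= locnorm0.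
by rewrite /pairing mulmx0 mxE cmod0.
Qed.

Lemma mu_ge0 : (0 <= mu rho f x)%E.
Proof.
rewrite /mu; case: ifP => // _.
apply: ereal_sup_ubound; exists 0; last by rewrite mulmx0 xnorm0.
rewrite /= (_ : hnorm _ = 0) ?ler01//.
by rewrite /hnorm big1 ?sqrtr0// => i _; rewrite mxE cmod0 expr0n.
Qed.

Hypothesis f_neq0 : forall i, f i != 0.

Lemma hnorm_f_gt0 i : 0 < hnorm (f i).
Proof.
rewrite lt_def hnorm_ge0 andbT; apply: contra_neq (f_neq0 i) => fi0.
by apply/ffunP => a; rewrite ffunE (hnorm0_eq0 fi0).
Qed.

Let normf : 'M[R[i]]_n := diag_mx (\row_i (hnorm (f i))%:C).

(** * Bounds through a finite upper bound of [mu], for invertible [DS] *)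

Section Invertible.
Hypothesis DS_unit : DS rho f x \in unitmx.
Context (m : R).
Hypothesis mu_le : (mu rho f x <= m%:E)%E.

Let M := invmx (DS rho f x) *m normf.

Lemma xnorm_le_mu v : xnorm rho x (M *m v) <= m * hnorm (fun j => v j 0).
Proof.
have unit_le (w : 'cV[R[i]]_n) : hnorm (fun j => w j 0) <= 1 ->
    xnorm rho x (M *m w) <= m.
  move=> w1; rewrite -lee_fin; apply: le_trans mu_le; rewrite /mu DS_unit.
  by apply: ereal_sup_ubound; exists w.
have [v0|v_gt0] := eqVneq (hnorm (fun j => v j 0)) 0.
  rewrite v0 mulr0 (_ : v = 0) ?mulmx0 ?xnorm0//.
  by apply/colP => j; rewrite (hnorm0_eq0 v0) mxE.
have {}v_gt0 : 0 < hnorm (fun j => v j 0) by rewrite lt_def v_gt0 hnorm_ge0.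
have := unit_le (((hnorm (fun j => v j 0))^-1)%:C *: v).
rewrite -scalemxAr xnormZ ?invr_ge0 ?hnorm_ge0//.
rewrite (_ : hnorm _ = 1); last first.
  under [X in hnorm X]eq_fun do rewrite mxE.
  by rewrite hnormZ ?invr_ge0 ?hnorm_ge0// mulVf// gt_eqF.
by move=> /(_ (lexx _)); rewrite mulrC ler_pdivrMr.
Qed.

(** Since DS M = diag(|f_i|), [cmod_DS_le] at Mv reads |f_i| |v_i| <= |f_i| |Mv|_i. Summing squares
    gives |v| <= |Mv|_x, which is at most [m] for a basis vector v. *)
Lemma mu_ge1 : 1 <= m.
Proof.
pose i0 := Ordinal n_ge1.
pose v : 'cV[R[i]]_n := delta_mx i0 0.
have v1 : hnorm (fun j => v j 0) = 1.
  rewrite /hnorm (bigD1 i0)//= big1 => [|j ji].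
    by rewrite mxE !eqxx (cmod_real 1) normr1 addr0 expr1n sqrtr1.
  by rewrite mxE (negPf ji) cmod0 expr0n.
have := xnorm_le_mu v; rewrite v1 mulr1; apply: le_trans.
rewrite -v1 -(@ler_pXn2r _ 2)// ?nnegrE ?hnorm_ge0 ?xnorm_ge0//.
rewrite hnorm_sqr xnorm_sqr; apply: ler_sum => i _.
rewrite lerXn2r ?nnegrE ?cmod_ge0 ?locnorm_ge0//.
have := cmod_DS_le i (M *m v).
rewrite /M !mulmxA mulmxV// mul1mx /normf mul_diag_mx !mxE.
by rewrite cmodM cmod_real ger0_norm ?hnorm_ge0// ler_pM2l// hnorm_f_gt0.
Qed.

Lemma xnorm_invDS_DkS_le (N : R) u us : 0 <= N -> (nu rho x <= N%:E)%E ->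
  (forall v, v \in u :: us -> xnorm rho x v <= 1) ->
  xnorm rho x (invmx (DS rho f x) *m DkS rho f x (u :: us)) <= m * N ^+ size us.
Proof.
move=> N0 nuN us1.
(* Dividing coordinate i by |f_i| exposes the operator [M] whose norm [mu] measures. *)
pose v : 'cV[R[i]]_n :=
  \col_i (((hnorm (f i))^-1)%:C * DkS rho f x (u :: us) i 0).
have -> : invmx (DS rho f x) *m DkS rho f x (u :: us) = M *m v.
  rewrite /M -mulmxA /normf mul_diag_mx; congr (_ *m _); apply/colP => i.
  rewrite !mxE mulrA -rmorphM/= divff ?mul1r//.
  by rewrite gt_eqF// hnorm_f_gt0.
apply: le_trans (xnorm_le_mu v) _.
rewrite ler_wpM2l ?(le_trans ler01 mu_ge1)//.
rewrite -(@ler_pXn2r _ 2)// ?nnegrE ?hnorm_ge0 ?exprn_ge0// hnorm_sqr.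
(* The squares of the local norms of [u] add up to that of [xnorm], so summing over i costs no
   factor n. *)
apply: (@le_trans _ _ ((N ^+ size us * xnorm rho x u) ^+ 2)).
  rewrite exprMn xnorm_sqr mulr_sumr; apply: ler_sum => i _.
  rewrite mxE cmodM cmod_real ger0_norm ?invr_ge0 ?hnorm_ge0// exprMn exprVn.
  rewrite ler_pdivrMl ?exprn_gt0 ?hnorm_f_gt0// -!exprMn mulrA.
  by apply: cmod_DkS_cons_le => // w wus; rewrite us1// inE wus orbT.
rewrite lerXn2r ?nnegrE ?mulr_ge0 ?exprn_ge0 ?xnorm_ge0//.
by rewrite ler_piMr ?exprn_ge0// us1// mem_head.
Qed.

End Invertible.
End Estimates.

(** * Infinite values, the factorial bound, and the conclusion *)

Lemma mule_top_pinfty (R : realType) (y : \bar R) : (0 <= y)%E ->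
  mule_top +oo%E y = +oo%E /\ mule_top y +oo%E = +oo%E.
Proof.
rewrite /mule_top eqxx/= andbT andbF; have [->|y0] := eqVneq y 0%E => // y_ge0.
have y_gt0 : (0 < y)%E by rewrite lt_def y0.
by rewrite orbF gt0_mulye// gt0_muley//; case: ifP.
Qed.

Lemma expn2_le_fact k : (2 ^ k <= k.+1`!)%N.
Proof. by elim: k => // k ih; rewrite expnS factS leq_mul. Qed.

(** The order of differentiation is [k.+2], so the root is of order [k.+1]. Both 2^(k+1) <= (k+2)!
    and m <= m^(k+1) enter, the latter from m >= 1. *)
Lemma root_fact_le (R : realType) (m N : R) (k : nat) : 1 <= m -> 0 <= N ->
  (((k.+2)`!%:R)^-1 * (m * N ^+ k.+1)) `^ (k.+1%:R)^-1 <= 2^-1 * (m * N).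
Proof.
move=> m1 N0; have m0 : 0 <= m by exact: le_trans m1.
have mN0 : 0 <= 2^-1 * (m * N) by rewrite !mulr_ge0.
have -> : 2^-1 * (m * N) = ((2^-1 * (m * N)) ^+ k.+1) `^ (k.+1%:R)^-1.
  by rewrite -powR_mulrn// -powRrM mulfV ?pnatr_eq0// powRr1.
apply: ge0_ler_powR; rewrite ?nnegrE ?invr_ge0 ?mulr_ge0 ?invr_ge0 ?exprn_ge0//.
rewrite !exprMn exprVn ler_pM ?invr_ge0 ?mulr_ge0 ?exprn_ge0//.
  rewrite lef_pV2 ?posrE ?exprn_gt0 ?ltr0n ?fact_gt0// -natrX ler_nat.
  exact: expn2_le_fact.
by rewrite ler_wpM2r ?exprn_ge0// ler_eXnr.
Qed.

Theorem theorem3p6p1 (R : realType) (n : nat) (n_ge1 : (1 <= n)%N)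
    (A : 'I_n -> {fset 'rV[R]_n}) (A_neq0 : forall i, A i != fset0)
    (rho : forall i, A i -> R) (rho_gt0 : forall i (a : A i), 0 < rho i a)
    (f : forall i, expsum A i) (f_neq0 : forall i, f i != 0)
    (X : quotV rho) (x : 'cV[R[i]]_n) (xX : in_class X x) :
  (gamma rho f x <= (2^-1)%:E * mule_top (mu rho f x) (nu rho x))%E.
Proof.
have mu0 := mu_ge0 f rho_gt0 A_neq0 x.
have nu0 := nu_ge0 rho_gt0 A_neq0 x n_ge1.
have half_gt0 : (0 < (2^-1)%:E :> \bar R)%E by rewrite lte_fin invr_gt0.
(* If [mu] or [nu] is infinite, the right side is [+oo], even when the other factor is 0, by the
   convention of [mule_top]. *)
case mE : (mu rho f x) mu0 => [m||]// mu0; last first.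
  by have [-> _] := mule_top_pinfty nu0; rewrite gt0_muley// leey.
case NE : (nu rho x) nu0 => [N||]// nu0; last first.
  by have [_ ->] := mule_top_pinfty mu0; rewrite gt0_muley// leey.
(* A singular [DS] would make [mu] infinite. *)
have DS_unit : DS rho f x \in unitmx.
  by move: mE; rewrite /mu; case: ifP.
have mle : (mu rho f x <= m%:E)%E by rewrite mE.
have Nle : (nu rho x <= N%:E)%E by rewrite NE.
have m1 := mu_ge1 rho_gt0 A_neq0 n_ge1 f_neq0 DS_unit mle.
rewrite lee_fin in nu0.
rewrite /mule_top !andbF/= -!EFinM /gamma DS_unit.
apply: ge_ereal_sup => _ [[//|[//|k]] _ <-] /=.
have mult_le : (multinorm rho x k.+2
    (fun us => invmx (DS rho f x) *m DkS rho f x us)%R <= (m * N ^+ k.+1)%:E)%E.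
  apply: ge_ereal_sup => _ [us us1 <-].
  have {us1} : forall v, v \in us -> xnorm rho x v <= 1.
    by move=> v /tnthP[j ->].
  case: us => -[//|u us]/= us_size us1.
  have -> : k.+1 = size us by case/eqP: (us_size) => ->.
  rewrite lee_fin.
  exact: (xnorm_invDS_DkS_le rho_gt0 A_neq0 n_ge1 f_neq0 DS_unit mle).
(* Monotonicity of the extended power is applied on nonnegative bases; the tuple of zero vectors
   shows that the supremum is one. *)
have mult_ge : (0 <= multinorm rho x k.+2
    (fun us => invmx (DS rho f x) *m DkS rho f x us)%R)%E.
  apply: (@le_trans _ _ (xnorm rho x (invmx (DS rho f x) *m
    DkS rho f x [tuple of nseq k.+2 0]))%:E); first by rewrite lee_fin xnorm_ge0.
  apply: ereal_sup_ubound; exists [tuple of nseq k.+2 0] => // j.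
  by rewrite tnth_nseq xnorm0.
have fact_ge0 : 0 <= (k.+2`!%:R : R)^-1 by rewrite invr_ge0.
apply: (@le_trans _ _
    (((k.+2`!%:R)^-1 * (m * N ^+ k.+1))%:E `^ (k.+1%:R)^-1)%E); last first.
  by rewrite poweR_EFin lee_fin root_fact_le.
apply: gt0_ler_poweR; rewrite ?invr_ge0// ?in_itv/= ?leey ?andbT.
- by rewrite mule_ge0.
- by rewrite lee_fin !mulr_ge0 ?exprn_ge0// (le_trans ler01).
- by rewrite EFinM lee_wpmul2l// lee_fin.
Qed.
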